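(* Let $\theta, \epsilon$ be real numbers with $\frac12 \ge \theta > 0$ and $q^{-1}(\theta) > \epsilon > 0$, and let $\zeta := q^{-1}(\theta) - \epsilon$. Suppose that the parameters $(k, N)$ of the algorithm shortstep satisfy $$\theta^{2^N} \le \epsilon^2, \qquad \tfrac{1}{2}\log k = q^{-1}\!\left(\tfrac{1}{m}\zeta^2\right).$$ Let $\mu_0 > \mu_f > 0$. Then the following hold for shortstep given input $(\hat v(\mu_0), \mu_0, \mu_f)$: (a) At most $N \left\lceil c^{-1}\sqrt{m}\, \log\frac{\mu_0}{\mu_f} \right\rceil$ Newton steps execute, where $c := 2 q^{-1}(\zeta^2)$. (b) The output $(v,\mu)$ satisfies $\|v - \hat v(\mu)\| \le \epsilon$ and $\mu \le \mu_f$.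
   Context: Data and standing assumptions: $A\in\mathbb{R}^{m\times n}$, $b\in\mathbb{R}^m$, $c_{\mathrm{obj}}\in\mathbb{R}^n$ (the linear cost vector), and $W\in\mathbb{R}^{n\times n}$ symmetric positive semidefinite define the quadratic program: minimize $\frac12 x^TWx + c_{\mathrm{obj}}^Tx$ subject to $Ax+b\ge 0$. It is assumed that (i) there exists $x\in\mathbb{R}^n$ with $Ax+b>0$ (componentwise); (ii) for every $\beta\in\mathbb{R}$ the set $\{x: \frac12 x^TWx + c_{\mathrm{obj}}^Tx\le\beta,\ Ax+b\ge0\}$ is bounded; (iii) $A^TA+W$ is positive definite. Notation: $\circ$ is the elementwise product, $e^v$ is the elementwise exponential, $\|\cdot\|$ is the Euclidean norm, $q(t) := 2(\cosh(t)-1)$, and $q^{-1}$ denotes the nonnegative inverse of $q$ on $[0,\infty)$. Centered point: for $\mu>0$, $\hat v(\mu)$ is the unique $v\in\mathbb{R}^m$ such that, for some $x\in\mathbb{R}^n$, $\sqrt\mu A^Te^v = Wx+c_{\mathrm{obj}}$ and $\sqrt\mu e^{-v} = Ax+b$. (It exists and is unique under the standing assumptions.) Newton direction: for $v\in\mathbb{R}^m$ and $\mu>0$, $d(v,\mu)\in\mathbb{R}^m$ is the (unique) $d$ that, together with a (unique) $x=x(v,\mu)\in\mathbb{R}^n$, satisfies $\sqrt\mu A^T(e^v+e^v\circ d) = Wx+c_{\mathrm{obj}}$ and $\sqrt\mu(e^{-v}-e^{-v}\circ d) = Ax+b$. Algorithm shortstep, with parameters $k$ (a real number) and $N$ (a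 positive integer), on input $(v_0,\mu_0,\mu_f)$: set $v\leftarrow v_0$, $\mu\leftarrow\mu_0$. While $\mu>\mu_f$: set $\mu\leftarrow \mu/k$, then perform $N$ times the update (a Newton step) $v\leftarrow v+d(v,\mu)$. Return $(v,\mu)$. *)

(* Defs.v *)
From HB Require Import structures.
From mathcomp Require Import all_boot all_order all_algebra.
From mathcomp Require Import all_classical all_reals all_analysis.

Set Implicit Arguments.
Unset Strict Implicit.
Unset Printing Implicit Defensive.

Import Order.TTheory GRing.Theory Num.Theory.

Local Open Scope classical_set_scope.
Local Open Scope ring_scope.

(* The Euclidean norm: the library's `|v| on matrices is the sup norm. *)
Definition enorm (R : realType) (n : nat) (v : 'cV[R]_n) : R :=
  Num.sqrt (\sum_i v i 0 ^+ 2).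

Definition expv (R : realType) (n : nat) (v : 'cV[R]_n) : 'cV[R]_n :=
  map_mx expR v.

Definition hadamard (R : realType) (n : nat) (u v : 'cV[R]_n) : 'cV[R]_n :=
  map2_mx *%R u v.

Definition pos_semidef (R : realType) (n : nat) (M : 'M[R]_n) : Prop :=
  M^T = M /\ forall x : 'cV[R]_n, 0 <= (x^T *m M *m x) 0 0.

Definition pos_def (R : realType) (n : nat) (M : 'M[R]_n) : Prop :=
  M^T = M /\ forall x : 'cV[R]_n, x != 0 -> 0 < (x^T *m M *m x) 0 0.

Definition cosh (R : realType) (t : R) : R := (expR t + expR (- t)) / 2.

Definition q (R : realType) (t : R) : R := 2 * (cosh t - 1).

(* q is a bijection of [0, +oo[ onto itself, so for 0 <= y the set below is a
   singleton; the default value 0 is used only for y < 0. *)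
Definition qinv (R : realType) (y : R) : R :=
  xget 0 [set t : R | 0 <= t /\ q t = y].

Section QuadraticProgram.
Variables (R : realType) (m n : nat).
Variables (A : 'M[R]_(m, n)) (b : 'cV[R]_m) (cobj : 'cV[R]_n) (W : 'M[R]_n).

Definition objective (x : 'cV[R]_n) : R :=
  2^-1 * (x^T *m W *m x) 0 0 + (cobj^T *m x) 0 0.

Definition feasible (x : 'cV[R]_n) : Prop :=
  forall i, 0 <= (A *m x + b) i 0.

Definition strictly_feasible (x : 'cV[R]_n) : Prop :=
  forall i, 0 < (A *m x + b) i 0.

Definition bounded_sublevel_sets : Prop :=
  forall beta : R, exists M : R,
    forall x, objective x <= beta -> feasible x -> enorm x <= M.

Definition is_centered (mu : R) (v : 'cV[R]_m) : Prop :=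
  exists x : 'cV[R]_n,
    Num.sqrt mu *: (A^T *m expv v) = W *m x + cobj /\
    Num.sqrt mu *: expv (- v) = A *m x + b.

Definition centered_point (mu : R) : 'cV[R]_m :=
  xget 0 [set v | is_centered mu v].

Definition is_newton_direction (v : 'cV[R]_m) (mu : R) (d : 'cV[R]_m) : Prop :=
  exists x : 'cV[R]_n,
    Num.sqrt mu *: (A^T *m (expv v + hadamard (expv v) d)) = W *m x + cobj /\
    Num.sqrt mu *: (expv (- v) - hadamard (expv (- v)) d) = A *m x + b.

Definition newton_direction (v : 'cV[R]_m) (mu : R) : 'cV[R]_m :=
  xget 0 [set d | is_newton_direction v mu d].

Definition newton_step (mu : R) (v : 'cV[R]_m) : 'cV[R]_m :=
  v + newton_direction v mu.

(* [shortstep k N muf v mu v' mu' s]: the loop started in state (v, mu)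
   terminates and returns (v', mu') after executing s Newton steps in total. *)
Inductive shortstep (k : R) (N : nat) (muf : R) :
    'cV[R]_m -> R -> 'cV[R]_m -> R -> nat -> Prop :=
| shortstep_exit v mu :
    mu <= muf -> shortstep k N muf v mu v mu 0
| shortstep_loop v mu v' mu' s :
    muf < mu ->
    shortstep k N muf (iter N (newton_step (mu / k)) v) (mu / k) v' mu' s ->
    shortstep k N muf v mu v' mu' (N + s).

End QuadraticProgram.

(* Main.v *)
(* Two primal-dual pairs (lambda, s), (lambda', s') with A^T lambda = W x + c and
   s = A x + b satisfy (lambda - lambda').(s - s') = (x - x').W(x - x') >= 0.
   Applied to two centered points this gives
   sum_i q(vhat(mu)_i - vhat(mu')_i) <= m q(log(mu / mu') / 2), which is zeta^2 for
   mu' = mu / k. Applied to a centered point and a Newton direction d at v, with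
   u = vhat - v, it gives |d - sinh u|^2 <= sum_i q(u_i)^2 / 4; since sinh u - u is
   at most 7/20 q(u), one Newton step squares the divergence h = sum_i q(u_i) as soon
   as h <= 1/2. As |w|^2 <= sum_i q(w_i) <= q(|w|), an iterate within eps of
   vhat(mu) has h <= q(eps + zeta) = theta with respect to vhat(mu / k), and
   N Newton steps bring h below theta^(2^N) <= eps^2. The inequality
   sum_i q(w_i) <= q(|w|) at a constant vector w also gives
   log k >= c / sqrt m, hence the bound on the number of outer iterations. *)

Require Import Defs.
From mathcomp Require Import all_boot all_order all_algebra.
From mathcomp Require Import all_classical all_reals all_analysis.
From mathcomp Require Import ring lra.

Set Implicit Arguments.
Unset Strict Implicit.
Unset Printing Implicit Defensive.

Import Order.TTheory GRing.Theory Num.Theory.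
Import numFieldNormedType.Exports.

Local Open Scope ring_scope.

(** * Scalar estimates for [q], [sinh] and [qinv] *)

Section ScalarBounds.
Variable R : realType.
Implicit Types s t u w y : R.

Definition sinh t : R := (expR t - expR (- t)) / 2.

Lemma expR_sqr_half t : expR t = expR (t / 2) ^+ 2.
Proof. by rewrite expr2 -expRD -splitr. Qed.

Lemma qE t : q t = expR t + expR (- t) - 2.
Proof. by rewrite /q /Defs.cosh; field. Qed.

Lemma qN t : q (- t) = q t.
Proof. by rewrite !qE opprK [expR (- t) + _]addrC. Qed.

Lemma q0 : q 0 = 0 :> R.
Proof. by rewrite qE oppr0 expR0; lra. Qed.

Lemma sinhN t : sinh (- t) = - sinh t.
Proof. by rewrite /sinh opprK; field. Qed.

Lemma q_sinh t : q t = 4 * sinh (t / 2) ^+ 2.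
Proof.
rewrite qE (expR_sqr_half t) (expR_sqr_half (- t)) mulNr /sinh.
have := expRxMexpNx_1 (t / 2); set a := expR _; set b := expR _ => ab.
by rewrite expr_div_n; field: ab.
Qed.

Lemma sinh_sqr t : sinh t ^+ 2 = q t + q t ^+ 2 / 4.
Proof.
have := expRxMexpNx_1 t; rewrite /sinh qE; set a := expR _; set b := expR _ => ab.
by field: ab.
Qed.

Lemma q_abs t : q `|t| = q t.
Proof. by case: (ler0P t) => _ //; rewrite qN. Qed.

Lemma sinh_homo_le s t : s <= t -> sinh s <= sinh t.
Proof.
move=> st; rewrite /sinh ler_pM2r ?invr_gt0//.
by rewrite lerB// ler_expR// lerN2.
Qed.

Lemma sinh_homo_lt s t : s < t -> sinh s < sinh t.
Proof.
move=> st; rewrite /sinh ltr_pM2r ?invr_gt0//.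
by rewrite ltrB// ltr_expR// ltrN2.
Qed.

Lemma sinh0 : sinh 0 = 0.
Proof. by rewrite /sinh oppr0 subrr mul0r. Qed.

Lemma sinh_ge0 t : 0 <= t -> 0 <= sinh t.
Proof. by move=> t0; rewrite -sinh0; exact: sinh_homo_le. Qed.

Lemma q_ge0 t : 0 <= q t.
Proof. by rewrite q_sinh mulr_ge0// sqr_ge0. Qed.

Lemma q_le s t : 0 <= s -> s <= t -> q s <= q t.
Proof.
move=> s0 st; rewrite !q_sinh ler_pM2l// ler_sqr ?nnegrE ?sinh_ge0//.
- by apply: sinh_homo_le; lra.
- by lra.
- by lra.
Qed.

Lemma q_lt s t : 0 <= s -> s < t -> q s < q t.
Proof.
move=> s0 st; rewrite !q_sinh ltr_pM2l// ltr_sqr ?nnegrE ?sinh_ge0//.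
- by apply: sinh_homo_lt; lra.
- by lra.
- by lra.
Qed.

(** The derivative of [sinh] is written [1 + q c / 2] instead of [cosh c], so that the sign and the
    monotonicity of [q] give bounds on slopes. *)
Lemma sinh_MVT s t : s <= t ->
  exists2 c, s <= c <= t & sinh t - sinh s = (1 + q c / 2) * (t - s).
Proof.
move=> st.
have dsinh : forall x : R, is_derive x 1 sinh (1 + q x / 2).
  move=> x; rewrite /sinh; apply: is_derive_eq.
  by rewrite qE /GRing.scale/=; field.
have [|c] := @MVT_segment _ sinh (fun c => 1 + q c / 2) _ _ st.
- apply: continuous_subspaceT => x.
  by apply: differentiable_continuous; apply/derivable1_diffP; case: (dsinh x).
- by rewrite in_itv => ? ?; exists c.
Qed.

Lemma sinh_ge t : 0 <= t -> t <= sinh t.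
Proof.
move=> t0; have [c _] := sinh_MVT t0; rewrite sinh0 !subr0 => ->.
by have := q_ge0 c; nra.
Qed.

Lemma q_ge_sqr t : t ^+ 2 <= q t.
Proof.
rewrite -q_abs -(real_normK (num_real t)) q_sinh; set a := `|t|.
have a0 : 0 <= a / 2 by rewrite divr_ge0 ?normr_ge0.
have := sinh_ge a0; nra.
Qed.

(** [sinh] vanishes at 0 and is convex on the nonnegative half-line: its mean slope on [[0, l * t]]
    is at most its mean slope on [[l * t, t]]. *)
Lemma sinh_scale l t : 0 <= t -> 0 <= l <= 1 -> sinh (l * t) <= l * sinh t.
Proof.
move=> t0 /andP[l0 l1].
have lt0 : 0 <= l * t by exact: mulr_ge0.
have ltt : l * t <= t by nra.
have [c1 /andP[c10 c1l]] := sinh_MVT lt0.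
have [c2 /andP[c2l _]] := sinh_MVT ltt.
rewrite sinh0 !subr0 => E2 E1.
have qc : q c1 <= q c2 by apply: q_le => //; exact: le_trans c2l.
have : (1 + q c1 / 2) * (l * t) * (1 - l) <= l * ((1 + q c2 / 2) * (t - l * t)).
  have -> : (1 + q c1 / 2) * (l * t) * (1 - l) = (1 + q c1 / 2) * (l * t * (1 - l)).
    by ring.
  have -> : l * ((1 + q c2 / 2) * (t - l * t)) = (1 + q c2 / 2) * (l * t * (1 - l)).
    by ring.
  by apply: ler_wpM2r; [rewrite mulr_ge0// subr_ge0 | lra].
rewrite -E1 -E2; nra.
Qed.

(** By [q_sinh] this is the square of [sinh_scale] at [t / 2]. It is the source of both
    [qsum_le_enorm] and the lower bound on [ln k]. *)
Lemma q_scale l t : 0 <= l <= 1 -> q (l * t) <= l ^+ 2 * q t.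
Proof.
move=> l01; rewrite -q_abs -(q_abs t) normrM; case/andP: (l01) => l0 _.
rewrite (ger0_norm l0) !q_sinh -mulrA; set a := `|t| / 2.
have a0 : 0 <= a by rewrite divr_ge0.
rewrite [X in _ <= X]mulrCA -exprMn ler_pM2l// ler_sqr ?nnegrE.
- exact: sinh_scale.
- by rewrite sinh_ge0// mulr_ge0.
- by rewrite mulr_ge0// sinh_ge0.
Qed.

Lemma sinh_le t : 0 <= t < 1 -> sinh t <= t * (1 - t / 2) / (1 - t).
Proof.
move=> /andP[t0 t1]; have t1' : 0 < 1 - t by lra.
have e1 : expR t <= (1 - t)^-1.
  rewrite -[expR t]invrK -expRN lef_pV2 ?posrE ?expR_gt0//.
  exact: expR_ge1Dx.
have e2 := expR_ge1Dx (- t).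
have -> : t * (1 - t / 2) / (1 - t) = ((1 - t)^-1 - (1 - t)) / 2.
  by field; rewrite gt_eqF.
rewrite /sinh; lra.
Qed.

Lemma q_le_sqr t : t ^+ 2 <= 1 / 2 -> q t <= 5 / 3 * t ^+ 2.
Proof.
rewrite -q_abs -(real_normK (num_real t)); set a := `|t| => ha.
have a0 : 0 <= a by exact: normr_ge0.
have a1 : a <= 71 / 100 by nra.
have s01 : 0 <= a / 2 < 1 by lra.
have := sinh_le s01; rewrite q_sinh; set s := a / 2 => hs.
(* For [s <= 71 / 200] the factor [(1 - s / 2) / (1 - s)] is below [128 / 100], whose square is
   below [5 / 3]. *)
have {}hs : sinh s <= 128 / 100 * s.
  apply: (le_trans hs); rewrite ler_pdivrMr /s; last by lra.
  by nra.
have s0 : 0 <= sinh s by apply: sinh_ge0; case/andP: s01.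
rewrite /s in hs s0 *; nra.
Qed.

Lemma q_le_sqr_small t : t ^+ 2 <= 1 / 5 -> q t <= 4 / 3 * t ^+ 2.
Proof.
rewrite -q_abs -(real_normK (num_real t)); set a := `|t| => ha.
have a0 : 0 <= a by exact: normr_ge0.
have a1 : a <= 45 / 100 by nra.
have s01 : 0 <= a / 2 < 1 by lra.
have := sinh_le s01; rewrite q_sinh; set s := a / 2 => hs.
have {}hs : sinh s <= 1151 / 1000 * s.
  apply: (le_trans hs); rewrite ler_pdivrMr /s; last by lra.
  by nra.
have s0 : 0 <= sinh s by apply: sinh_ge0; case/andP: s01.
rewrite /s in hs s0 *; nra.
Qed.

(* For [u >= 0], [sinh u - u - q u / 2 = 1 - u - expR (- u)] and
   [expR (- u) = expR (- u / 2) ^+ 2 >= 1 - u + u ^+ 2 / 4]. *)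
Lemma sinh_sub_le u : q u <= 1 / 2 -> `|sinh u - u| <= 7 / 20 * q u.
Proof.
wlog u0 : u / 0 <= u => [wlogu|] qu.
  have [/wlogu->//|u0] := leP 0 u.
  rewrite -qN -normrN (_ : - (sinh u - u) = sinh (- u) - - u).
    by apply: wlogu; rewrite ?qN// oppr_ge0 ltW.
  by rewrite sinhN opprK opprB addrC.
have u2 : u ^+ 2 <= 1 / 2 by apply: le_trans qu; exact: q_ge_sqr.
have u1 : u <= 1 by nra.
have := q_le_sqr u2.
have := sinh_ge u0.
have := expR_ge1Dx (- (u / 2)).
have := expR_sqr_half (- u); rewrite mulNr.
have := qE u; rewrite /sinh.
set a := expR u; set b := expR (- u); set c := expR _ => -> -> c1 su q2.
rewrite ger0_norm ?subr_ge0//.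
nra.
Qed.

Lemma qinvP y : 0 <= y -> 0 <= qinv y /\ q (qinv y) = y.
Proof.
move=> y0; apply: (@xgetPex _ 0 [set t : R | 0 <= t /\ q t = y]%classic).
(* [q t = y] means [cosh t = 1 + y / 2]; the witness is the logarithmic formula for the inverse
   hyperbolic cosine. *)
set r := Num.sqrt ((1 + y / 2) ^+ 2 - 1).
have r2 : r ^+ 2 = (1 + y / 2) ^+ 2 - 1 by rewrite sqr_sqrtr//; nra.
have r0 : 0 <= r by exact: sqrtr_ge0.
have z0 : 0 < 1 + y / 2 + r by nra.
exists (ln (1 + y / 2 + r)) => /=; split; first by apply: ln_ge0; lra.
rewrite qE expRN lnK ?posrE//.
have -> : (1 + y / 2 + r)^-1 = 1 + y / 2 - r.
  apply: (mulfI (lt0r_neq0 z0)); rewrite mulfV ?gt_eqF//.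
  by rewrite mulrC -subr_sqr r2; ring.
by field.
Qed.

Lemma qinv_ge0 y : 0 <= y -> 0 <= qinv y.
Proof. by case/qinvP. Qed.

Lemma qinvK y : 0 <= y -> q (qinv y) = y.
Proof. by case/qinvP. Qed.

Lemma qinv_gt0 y : 0 < y -> 0 < qinv y.
Proof.
move=> y0; rewrite lt_neqAle qinv_ge0 1?ltW// andbT eq_sym; apply/eqP => E.
by have := qinvK (ltW y0); rewrite E q0 => /esym/eqP; rewrite gt_eqF.
Qed.

Lemma le_qinv s y : 0 <= y -> q s <= y -> s <= qinv y.
Proof.
move=> y0 qs; rewrite leNgt; apply/negP => /(q_lt (qinv_ge0 y0)).
by rewrite qinvK// ltNge qs.
Qed.

End ScalarBounds.

(** * The Euclidean norm and its comparison with the divergence [qsum] *)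

Section EuclideanNorm.
Variables (R : realType) (m : nat).
Implicit Types u v w d : 'cV[R]_m.

Lemma enorm_sqr v : enorm v ^+ 2 = \sum_i v i 0 ^+ 2.
Proof. by rewrite sqr_sqrtr// sumr_ge0// => i _; exact: sqr_ge0. Qed.

Lemma enorm_ge0 v : 0 <= enorm v.
Proof. exact: sqrtr_ge0. Qed.

Lemma enorm0 : enorm (0 : 'cV[R]_m) = 0.
Proof.
apply/eqP; rewrite -sqrf_eq0 enorm_sqr big1// => i _.
by rewrite mxE expr0n.
Qed.

Lemma enorm_opp v : enorm (- v) = enorm v.
Proof. by congr Num.sqrt; apply: eq_bigr => i _; rewrite mxE sqrrN. Qed.

Lemma coord_le_enorm v i : `|v i 0| <= enorm v.
Proof.
rewrite -ler_sqr ?nnegrE ?enorm_ge0// enorm_sqr real_normK ?num_real//.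
by rewrite (bigD1 i)//= lerDl sumr_ge0// => j _; exact: sqr_ge0.
Qed.

(** With [a] and [b] the two norms, summing [0 <= (b * u i 0 - a * v i 0) ^+ 2] gives the claim
    multiplied by [2 * (a * b)]; vanishing norms are treated apart. *)
Lemma cauchy_schwarz u v : \sum_i u i 0 * v i 0 <= enorm u * enorm v.
Proof.
set a := enorm u; set b := enorm v.
have a0 : 0 <= a := enorm_ge0 u; have b0 : 0 <= b := enorm_ge0 v.
have coord0 (w : 'cV[R]_m) i : enorm w = 0 -> w i 0 = 0.
  by move=> w0; apply/eqP; rewrite -normr_le0 -w0 coord_le_enorm.
have [a_0|an0] := eqVneq a 0.
  by rewrite big1 ?mulr_ge0// => i _; rewrite (coord0 u)// mul0r.
have [b_0|bn0] := eqVneq b 0.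
  by rewrite big1 ?mulr_ge0// => i _; rewrite (coord0 v)// mulr0.
have ab0 : 0 < 2 * (a * b) by rewrite !mulr_gt0// lt_neqAle eq_sym ?an0 ?bn0.
rewrite -(ler_pM2l ab0).
have -> : 2 * (a * b) * (a * b) =
    \sum_i (b ^+ 2 * u i 0 ^+ 2 + a ^+ 2 * v i 0 ^+ 2).
  by rewrite big_split/= -!mulr_sumr -!enorm_sqr -/a -/b; ring.
rewrite mulr_sumr.
apply: ler_sum => i _; have := sqr_ge0 (b * u i 0 - a * v i 0); lra.
Qed.

Lemma enorm_triangle u v : enorm (u + v) <= enorm u + enorm v.
Proof.
rewrite -ler_sqr ?nnegrE ?addr_ge0 ?enorm_ge0//.
rewrite enorm_sqr sqrrD !enorm_sqr.
have -> : \sum_i (u + v) i 0 ^+ 2 =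
    \sum_i u i 0 ^+ 2 + (\sum_i u i 0 * v i 0) *+ 2 + \sum_i v i 0 ^+ 2.
  by rewrite -sumrMnl -!big_split/=; apply: eq_bigr => i _; rewrite mxE sqrrD.
by rewrite lerD2r lerD2l lerMn2r cauchy_schwarz.
Qed.

Definition qsum w : R := \sum_i q (w i 0).

Lemma qsum_ge0 w : 0 <= qsum w.
Proof. by apply: sumr_ge0 => i _; exact: q_ge0. Qed.

Lemma qsumN w : qsum (- w) = qsum w.
Proof. by apply: eq_bigr => i _; rewrite mxE qN. Qed.

Lemma q_coord_le_qsum w i : q (w i 0) <= qsum w.
Proof.
by rewrite /qsum (bigD1 i)//= lerDl sumr_ge0// => j _; exact: q_ge0.
Qed.

Lemma enorm_le_qsum w : enorm w ^+ 2 <= qsum w.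
Proof. by rewrite enorm_sqr; apply: ler_sum => i _; exact: q_ge_sqr. Qed.

(** Each [|w i 0|] is a fraction of the norm, so [q_scale] bounds its [q] by the squared fraction
    times [q (enorm w)], and the squared fractions sum to 1. *)
Lemma qsum_le_enorm w : qsum w <= q (enorm w).
Proof.
set a := enorm w; have a0 : 0 <= a := enorm_ge0 w.
have [a_0|an0] := eqVneq a 0.
  rewrite /qsum big1 ?q_ge0// => i _.
  have := coord_le_enorm w i; rewrite -/a a_0 normr_le0 => /eqP ->; exact: q0.
have {an0} agt0 : 0 < a by rewrite lt_neqAle eq_sym an0.
have -> : q a = \sum_i (`|w i 0| / a) ^+ 2 * q a.
  rewrite -mulr_suml; under eq_bigr do rewrite expr_div_n real_normK ?num_real//.
  by rewrite -mulr_suml -enorm_sqr mulfV ?mul1r// sqrf_eq0 gt_eqF.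
apply: ler_sum => i _; rewrite -q_abs -[X in q X](divfK (lt0r_neq0 agt0)).
apply: q_scale; rewrite divr_ge0//= ler_pdivrMr// mul1r.
exact: coord_le_enorm.
Qed.

Lemma qsum_sqr_le w : \sum_i q (w i 0) ^+ 2 <= qsum w ^+ 2.
Proof.
rewrite [X in _ <= X]expr2 {1}/qsum mulr_suml; apply: ler_sum => i _.
by rewrite expr2 ler_wpM2l ?q_ge0// q_coord_le_qsum.
Qed.

(* Writing [u - d = (sinh u - d) - (sinh u - u)], the two parts have norms at
   most [qsum u / 2] and [7/20 qsum u]. *)
Lemma qsum_newton u d : qsum u <= 1 / 2 ->
  \sum_i (d i 0 - sinh (u i 0)) ^+ 2 <= \sum_i q (u i 0) ^+ 2 / 4 ->
  qsum (u - d) <= qsum u ^+ 2.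
Proof.
set h := qsum u => h12 hd; have h0 : 0 <= h := qsum_ge0 u.
set r : 'cV[R]_m := \col_i (sinh (u i 0) - d i 0).
set e : 'cV[R]_m := \col_i (u i 0 - sinh (u i 0)).
have sq : \sum_i q (u i 0) ^+ 2 <= h ^+ 2 := qsum_sqr_le u.
have rh : enorm r <= h / 2.
  rewrite -ler_sqr ?nnegrE ?enorm_ge0 ?divr_ge0// enorm_sqr.
  under eq_bigr do rewrite mxE -sqrrN opprB.
  by apply: (le_trans hd); rewrite -mulr_suml; lra.
have eh : enorm e <= 7 / 20 * h.
  rewrite -ler_sqr ?nnegrE ?enorm_ge0 ?mulr_ge0// ?divr_ge0// enorm_sqr exprMn.
  apply: (@le_trans _ _ (\sum_i (7 / 20) ^+ 2 * q (u i 0) ^+ 2)).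
    apply: ler_sum => i _; rewrite mxE -sqrrN opprB -exprMn.
    rewrite -(real_normK (num_real (sinh _ - _))).
    rewrite ler_sqr ?nnegrE//; last by have := q_ge0 (u i 0); lra.
    by apply: sinh_sub_le; apply: le_trans h12; exact: q_coord_le_qsum.
  by rewrite -mulr_sumr ler_wpM2l// sqr_ge0.
have ude : u - d = r + e by apply/colP => i; rewrite !mxE; ring.
have wh : enorm (u - d) <= 17 / 20 * h.
  by rewrite ude; apply: (le_trans (enorm_triangle _ _)); lra.
have wh2 : enorm (u - d) ^+ 2 <= (17 / 20 * h) ^+ 2.
  by rewrite ler_sqr ?nnegrE ?enorm_ge0 ?mulr_ge0 ?divr_ge0.
(* Since [h <= 1 / 2], every squared coordinate is at most [(17 / 40) ^+ 2 < 1 / 5], as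
   [q_le_sqr_small] requires; then [4 / 3 * (17 / 20) ^+ 2 < 1] concludes. *)
apply: (@le_trans _ _ (4 / 3 * enorm (u - d) ^+ 2)); last by nra.
rewrite enorm_sqr mulr_sumr; apply: ler_sum => i _; apply: q_le_sqr_small.
apply: (@le_trans _ _ (enorm (u - d) ^+ 2)); last by nra.
rewrite -(real_normK (num_real ((u - d) i 0))) ler_sqr ?nnegrE ?enorm_ge0//.
exact: coord_le_enorm.
Qed.

End EuclideanNorm.

(** * Consequences of the monotonicity of the primal-dual equations *)

Section PrimalDual.
Variables (R : realType) (m n : nat).
Variables (A : 'M[R]_(m, n)) (b : 'cV[R]_m) (cobj : 'cV[R]_n) (W : 'M[R]_n).
Hypothesis W_psd : pos_semidef W.

Lemma primal_dual_monotone (l l' : 'cV[R]_m) (x x' : 'cV[R]_n) :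
  A^T *m l = W *m x + cobj -> A^T *m l' = W *m x' + cobj ->
  0 <= \sum_i (l i 0 - l' i 0) * ((A *m x + b) i 0 - (A *m x' + b) i 0).
Proof.
move=> E E'; have := W_psd.2 (x - x').
have -> : (x - x')^T *m W = (l - l')^T *m A.
  rewrite -[A]trmxK -trmx_mul mulmxBr E E' opprD addrACA subrr addr0.
  by rewrite -mulmxBr trmx_mul W_psd.1.
rewrite -mulmxA mxE; congr (_ <= _); apply: eq_bigr => i _.
by rewrite mulmxBr !mxE; ring.
Qed.

Lemma newton_direction_sinh (mu : R) v vhat d : 0 < mu ->
  is_centered A b cobj W mu vhat -> is_newton_direction A b cobj W v mu d ->
  \sum_i (d i 0 - sinh ((vhat - v) i 0)) ^+ 2 <=
  \sum_i q ((vhat - v) i 0) ^+ 2 / 4.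
Proof.
move=> mu0 [x' [E1' E2']] [x [E1 E2]].
have s0 : 0 < Num.sqrt mu by rewrite sqrtr_gt0.
rewrite scalemxAr in E1'; rewrite scalemxAr in E1.
have := primal_dual_monotone E1 E1'.
rewrite -E2 -E2' -[_ <= \sum_i _ / 4]subr_ge0 -sumrB.
(* With [u = vhat - v], each product is [mu] times [(1 + d - expR u) * (1 - d - expR (- u))], that
   is [sinh u ^+ 2 - q u - (d - sinh u) ^+ 2]; by [sinh_sqr] the first two terms amount to
   [q u ^+ 2 / 4]. *)
suff -> : \sum_i ((Num.sqrt mu *: (expv v + hadamard (expv v) d)) i 0 -
      (Num.sqrt mu *: expv vhat) i 0) *
    ((Num.sqrt mu *: (expv (- v) - hadamard (expv (- v)) d)) i 0 -
      (Num.sqrt mu *: expv (- vhat)) i 0) =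
    mu * \sum_i (q ((vhat - v) i 0) ^+ 2 / 4 -
      (d i 0 - sinh ((vhat - v) i 0)) ^+ 2).
  by rewrite pmulr_rge0.
rewrite mulr_sumr; apply: eq_bigr => i _.
rewrite sqrrB [sinh _ ^+ 2]sinh_sqr qE /sinh !mxE opprB !expRB.
rewrite !expRN -[in RHS](sqr_sqrtr (ltW mu0)).
by field; rewrite ?gt_eqF ?expR_gt0.
Qed.

Lemma centered_shift (mu mu' : R) v v' : 0 < mu -> 0 < mu' ->
  is_centered A b cobj W mu v -> is_centered A b cobj W mu' v' ->
  qsum (v - v') <= m%:R * q (2^-1 * ln (mu / mu')).
Proof.
move=> mu0 mu'0 [x [E1 E2]] [x' [E1' E2']].
have s0 : 0 < Num.sqrt mu by rewrite sqrtr_gt0.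
have s'0 : 0 < Num.sqrt mu' by rewrite sqrtr_gt0.
rewrite scalemxAr in E1'; rewrite scalemxAr in E1.
have := primal_dual_monotone E1 E1'.
rewrite -E2 -E2'.
set s := Num.sqrt mu in s0 *; set s' := Num.sqrt mu' in s'0 *.
have lnE : 2^-1 * ln (mu / mu') = ln (s / s').
  rewrite -[mu](sqr_sqrtr (ltW mu0)) -[mu'](sqr_sqrtr (ltW mu'0)) -/s -/s'.
  by rewrite -expr_div_n lnXn ?divr_gt0//; field.
have qE' : s * s' * q (2^-1 * ln (mu / mu')) = s ^+ 2 + s' ^+ 2 - 2 * (s * s').
  rewrite lnE qE expRN lnK ?posrE ?divr_gt0// invf_div; field.
  by rewrite !gt_eqF.
(* Each product equals [(s - s') ^+ 2 - s * s' * q (v i 0 - v' i 0)], and [qE'] rewrites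
   [(s - s') ^+ 2] as a multiple of [s * s'], which then cancels. *)
suff -> : \sum_i ((s *: expv v) i 0 - (s' *: expv v') i 0) *
    ((s *: expv (- v)) i 0 - (s' *: expv (- v')) i 0) =
    m%:R * (s * s' * q (2^-1 * ln (mu / mu'))) - s * s' * qsum (v - v').
  rewrite subr_ge0 mulrCA ler_pM2l//; exact: mulr_gt0.
rewrite qE' /qsum mulr_sumr.
have -> c : m%:R * c = \sum_(i < m) c by rewrite sumr_const card_ord mulr_natl.
rewrite -sumrB.
apply: eq_bigr => i _; rewrite qE !mxE opprB !expRB !expRN.
by field; rewrite ?gt_eqF ?expR_gt0.
Qed.

End PrimalDual.

(** * Entry rules that open sums and scalings but leave matrix products folded, unlike [mxE] *)

Section MatrixEntries.
Variables (R : pzRingType) (m n : nat).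

Lemma addmxE (P Q : 'M[R]_(m, n)) i j : (P + Q) i j = P i j + Q i j.
Proof. by rewrite mxE. Qed.

Lemma scalemxE (a : R) (P : 'M[R]_(m, n)) i j : (a *: P) i j = a * P i j.
Proof. by rewrite mxE. Qed.

End MatrixEntries.

(** * Solvability of the Newton system *)

Section NewtonExistence.
Variables (R : realType) (m n : nat).
Variables (A : 'M[R]_(m, n)) (b : 'cV[R]_m) (cobj : 'cV[R]_n) (W : 'M[R]_n).

Lemma anisotropic_unitmx (M : 'M[R]_n) :
  (forall x : 'cV[R]_n, (x^T *m M *m x) 0 0 = 0 -> x = 0) -> M \in unitmx.
Proof.
move=> Mx; rewrite -row_free_unit; apply: inj_row_free => y yM.
by rewrite -[y]trmxK (Mx y^T) ?trmx0// trmxK yM mul0mx mxE.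
Qed.

Lemma weighted_gram_form (e : 'rV[R]_m) (x : 'cV[R]_n) :
  (x^T *m (A^T *m diag_mx e *m A) *m x) 0 0 =
  \sum_i e 0 i * (A *m x) i 0 ^+ 2.
Proof.
rewrite !mulmxA -trmx_mul -[_ *m A *m x]mulmxA -mulmxA mul_diag_mx mxE.
by apply: eq_bigr => i _; rewrite !mxE expr2; ring.
Qed.

(** The second equation determines [d] from the slack [A *m x + b]; substituting it into the first
    leaves a linear system in [x] with matrix [W + A^T *m diag_mx e *m A], where [e] holds the
    squares of the entries of [expv v]. *)
Lemma newton_direction_exists v (mu : R) :
  pos_semidef W -> pos_def (A^T *m A + W) -> 0 < mu ->
  is_newton_direction A b cobj W v mu (newton_direction A b cobj W v mu).
Proof.
move=> Wpsd AWpd mu0.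
apply: (@xgetPex _ 0 [set d | is_newton_direction A b cobj W v mu d]%classic).
have s0 : 0 < Num.sqrt mu by rewrite sqrtr_gt0.
set s := Num.sqrt mu in s0 *.
pose e : 'rV[R]_m := \row_i expR (v i 0) ^+ 2.
have Mu : W + A^T *m diag_mx e *m A \in unitmx.
  apply: anisotropic_unitmx => x.
  rewrite mulmxDr mulmxDl addmxE weighted_gram_form => H.
  have W0 := Wpsd.2 x.
  have e0 i : 0 <= e 0 i * (A *m x) i 0 ^+ 2.
    by rewrite mulr_ge0 ?sqr_ge0// mxE sqr_ge0.
  have E0 : 0 <= \sum_i e 0 i * (A *m x) i 0 ^+ 2 by apply: sumr_ge0.
  (* Two nonnegative forms sum to 0, so both vanish. As the weights are positive, [A *m x = 0], and
     a nonzero [x] would contradict the definiteness of [A^T *m A + W]. *)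
  have /eqP : \sum_i e 0 i * (A *m x) i 0 ^+ 2 = 0 by lra.
  rewrite psumr_eq0// => /allP eA.
  have Ax0 : A *m x = 0.
    apply/colP => i; rewrite [RHS]mxE; apply/eqP.
    have := eA i (mem_index_enum i).
    by rewrite mulf_eq0 mxE !sqrf_eq0 gt_eqF// expR_gt0.
  apply/eqP; apply: contraT => /AWpd.2.
  rewrite mulmxDr mulmxDl mulmxA -!(mulmxA _ A) Ax0 mulmx0 add0r.
  by lra.
pose x := invmx (W + A^T *m diag_mx e *m A) *m
  (A^T *m (s *: expv v *+ 2 - diag_mx e *m b) - cobj).
have Ex : W *m x = A^T *m (s *: expv v *+ 2 - diag_mx e *m (A *m x + b)) - cobj.
  apply: (addIr (A^T *m diag_mx e *m A *m x)); rewrite -mulmxDl mulKVmx//.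
  rewrite [diag_mx e *m (_ + _)]mulmxDr opprD addrCA [in RHS]mulmxDr.
  by rewrite mulmxN !mulmxA [RHS]addrAC [- _ + _]addrC subrK.
exists (\col_i (1 - expR (v i 0) * (A *m x + b) i 0 / s)); exists x.
rewrite {}Ex -/s; move: (A *m x + b) => r {x}; split.
  rewrite subrK scalemxAr; congr (_ *m _); apply/colP => i.
  by rewrite mul_diag_mx !mxE; field; exact: lt0r_neq0.
apply/colP => i; rewrite !mxE expRN; field.
by rewrite !gt_eqF ?expR_gt0.
Qed.

End NewtonExistence.

(** * Existence of centered points by maximizing a barrier *)

Section CenteredPointExistence.
Variables (R : realType) (m n : nat).
Variables (A : 'M[R]_(m, n)) (b : 'cV[R]_m) (cobj : 'cV[R]_n) (W : 'M[R]_n).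
Hypothesis W_psd : pos_semidef W.
Local Notation obj := (objective cobj W).

Definition slope (x h : 'cV[R]_n) : R := (h^T *m (W *m x + cobj)) 0 0.
Definition curvature (h : 'cV[R]_n) : R := (h^T *m W *m h) 0 0.

Lemma curvature_ge0 h : 0 <= curvature h.
Proof. exact: W_psd.2. Qed.

Lemma objective_expand (x h : 'cV[R]_n) (t : R) :
  obj (x + t *: h) = obj x + t * slope x h + t ^+ 2 / 2 * curvature h.
Proof.
rewrite /objective /slope /curvature.
have -> : (x + t *: h)^T = x^T + t *: h^T by rewrite linearD linearZ.
have swap (u v : 'cV[R]_n) : (u^T *m v) 0 0 = (v^T *m u) 0 0.
  by rewrite -[in LHS](trmxK v) -trmx_mul mxE.
have swapW : (x^T *m W *m h) 0 0 = (h^T *m W *m x) 0 0.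
  by rewrite -mulmxA swap trmx_mul W_psd.1.
rewrite !mulmxDr !mulmxDl -!scalemxAl -!scalemxAr !mulmxA.
have -> : cobj^T *m h = h^T *m cobj.
  by apply/matrixP => i j; rewrite !ord1 swap.
rewrite !(addmxE, scalemxE) swapW.
by field.
Qed.

(** A second-order lower bound on [ln (1 + y)] in exponential form. It follows from [expR_ge1Dx] and
    [(1 + y) * (1 - y + 2 * y ^+ 2) = 1 + y ^+ 2 * (1 + 2 * y)]. *)
Lemma expR_le1D (y : R) : - (1 / 2) <= y -> expR (y - 2 * y ^+ 2) <= 1 + y.
Proof.
move=> y12; rewrite -[_ - _]opprK expRN.
have y1 : 0 < 1 + y by lra.
rewrite -[1 + y]invrK lef_pV2 ?posrE ?expR_gt0 ?invr_gt0//.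
apply: (le_trans _ (expR_ge1Dx _)).
rewrite -div1r ler_pdivrMr//; nra.
Qed.

Lemma exists_small (c e : R) : 0 <= c -> 0 < e ->
  exists t, [/\ 0 < t, t <= 1 & t * c < e].
Proof.
move=> c0 e0; exists (Num.min 1 (e / (c + 1))).
have c1 : 0 < c + 1 by lra.
split; first by rewrite lt_min ltr01 divr_gt0.
  by rewrite ge_min lexx.
have : Num.min 1 (e / (c + 1)) <= e / (c + 1) by rewrite ge_min lexx orbT.
have : 0 < Num.min 1 (e / (c + 1)) by rewrite lt_min ltr01 divr_gt0.
set t := Num.min _ _ => t0; rewrite ler_pdivlMr//; nra.
Qed.

Variable mu : R.
Hypothesis mu_gt0 : 0 < mu.

(* The exponential of minus the logarithmic barrier function over [mu]; unlike
   the latter, it extends continuously to the boundary of the feasible set. *)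
Definition barrier (x : 'cV[R]_n) : R :=
  (\prod_i (A *m x + b) i 0) * expR (- (obj x / mu)).

Lemma barrier_gt0 x : strictly_feasible A b x -> 0 < barrier x.
Proof. by move=> sx; rewrite mulr_gt0 ?expR_gt0// prodr_gt0. Qed.

Lemma slackD x h (t : R) i :
  (A *m (x + t *: h) + b) i 0 = (A *m x + b) i 0 + t * (A *m h) i 0.
Proof. by rewrite mulmxDr -scalemxAr !mxE; ring. Qed.

(** A first-order optimality condition obtained without differentiation: if the gain [L] were
    positive, the barrier would grow by a factor of at least [expR (t * L - t ^+ 2 * C)], which
    exceeds 1 for small [t]. *)
Lemma barrier_direction (x h : 'cV[R]_n) (tau : R) :
  strictly_feasible A b x -> 0 < tau ->
  (forall t : R, 0 < t -> t <= tau -> barrier (x + t *: h) <= barrier x) ->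
  \sum_i (A *m h) i 0 / (A *m x + b) i 0 <= slope x h / mu.
Proof.
move=> sx tau0 hmax; set s := fun i => (A *m x + b) i 0.
have s0 i : 0 < s i by exact: sx.
pose a i := (A *m h) i 0 / s i.
rewrite -/(a _) leNgt; apply/negP => hL.
set L := \sum_i a i - slope x h / mu.
(* [C] collects the second-order losses, from [expR_le1D] and from the quadratic objective. Below,
   [t1] ensures [t * C < L] and [t2] ensures [- (1 / 2) <= t * a i]. *)
pose C := \sum_i 2 * a i ^+ 2 + curvature h / 2 / mu.
pose S : R := \sum_i `|a i|.
have L0 : 0 < L by rewrite subr_gt0.
have C0 : 0 <= C.
  apply: addr_ge0; last by rewrite !divr_ge0 ?curvature_ge0// ltW.
  by apply: sumr_ge0 => i _; rewrite mulr_ge0 ?sqr_ge0.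
have S0 : 0 <= S by rewrite sumr_ge0.
have [t1 [t10 _ t1C]] := exists_small C0 L0.
have half_gt0 : 0 < 1 / 2 :> R by lra.
have [t2 [t20 _ t2S]] := exists_small S0 half_gt0.
pose t := Num.min tau (Num.min t1 t2).
have t0 : 0 < t by rewrite !lt_min tau0 t10.
have ttau : t <= tau by rewrite ge_min lexx.
have tt1 : t <= t1 by rewrite !ge_min lexx orbT.
have tt2 : t <= t2 by rewrite !ge_min lexx !orbT.
have ta i : - (1 / 2) <= t * a i.
  have : `|t * a i| <= 1 / 2.
    rewrite normrM (gtr0_norm t0); apply: le_trans (ltW t2S).
    apply: ler_pM => //; first exact: ltW.
    by rewrite /S (bigD1 i)//= lerDl sumr_ge0.
  by rewrite ler_norml => /andP[].
have := hmax t t0 ttau; apply/negP; rewrite -ltNge.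
have -> : barrier x = barrier x * expR 0 by rewrite expR0 mulr1.
apply: (@lt_le_trans _ _ (barrier x * expR (t * L - t ^+ 2 * C))).
  rewrite ltr_pM2l ?barrier_gt0// ltr_expR.
  have -> : t * L - t ^+ 2 * C = t * (L - t * C) by ring.
  rewrite mulr_gt0// subr_gt0; apply: le_lt_trans t1C.
  exact: ler_wpM2r.
have -> : barrier x * expR (t * L - t ^+ 2 * C) =
    (\prod_i (s i * expR (t * a i - 2 * (t * a i) ^+ 2))) *
    expR (- (obj (x + t *: h) / mu)).
  rewrite big_split/= -expR_sum objective_expand /barrier.
  rewrite -!mulrA -!expRD; congr (_ * expR _).
  rewrite sumrB -mulr_sumr /L /C.
  under [X in _ = _ - X + _]eq_bigr do rewrite exprMn mulrCA.
  by rewrite -[X in _ - X - _]mulr_sumr; field; rewrite gt_eqF.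
rewrite /barrier ler_wpM2r ?expR_ge0//; apply: ler_prod => i _.
rewrite mulr_ge0 ?expR_ge0//=; last exact: ltW.
have -> : (A *m (x + t *: h) + b) i 0 = s i * (1 + t * a i).
  by rewrite slackD /a -/(s i); field; rewrite gt_eqF.
by rewrite ler_pM2l//; apply: expR_le1D.
Qed.

(** Continuity is proved for row vectors read through a transpose, the form in which [EVT_max_rV] is
    applied. *)
Lemma linear_coord_continuous (k : nat) (B : 'M[R]_(k, n)) i :
  continuous (fun y : 'rV[R]_n => (B *m y^T) i 0).
Proof.
rewrite (_ : (fun y => _) = fun y : 'rV[R]_n => \sum_j B i j * y 0 j); last first.
  by apply/funext => y; rewrite mxE; apply: eq_bigr => j _; rewrite mxE.
apply: (continuous_big add_continuous) => j _ y.
by apply: continuousM; [exact: cst_continuous | exact: coord_continuous].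
Qed.

Lemma slack_continuous i :
  continuous (fun y : 'rV[R]_n => (A *m y^T + b) i 0).
Proof.
rewrite (_ : (fun y => _) = fun y : 'rV[R]_n => (A *m y^T) i 0 + b i 0); last first.
  by apply/funext => y; rewrite mxE.
move=> y; apply: continuousD; first exact: linear_coord_continuous.
exact: cst_continuous.
Qed.

Lemma objective_continuous : continuous (fun y : 'rV[R]_n => obj y^T).
Proof.
rewrite (_ : (fun y => _) = fun y : 'rV[R]_n =>
    2^-1 * (\sum_j y 0 j * (W *m y^T) j 0) + (cobj^T *m y^T) 0 0); last first.
  by apply/funext => y; rewrite /objective trmxK -mulmxA [(y *m _) 0 0]mxE.
move=> y; apply: (@continuousD _ _ _
  (fun y : 'rV[R]_n => 2^-1 * \sum_j y 0 j * (W *m y^T) j 0)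
  (fun y : 'rV[R]_n => (cobj^T *m y^T) 0 0)); last exact: linear_coord_continuous.
apply: continuousM; first exact: cst_continuous.
apply: (continuous_big add_continuous) => j _ {}y.
by apply: continuousM; [exact: coord_continuous | exact: linear_coord_continuous].
Qed.

Lemma barrier_continuous : continuous (fun y : 'rV[R]_n => barrier y^T).
Proof.
move=> y; apply: (@continuousM _ _ (fun y : 'rV[R]_n => \prod_i (A *m y^T + b) i 0)
  (fun y : 'rV[R]_n => expR (- (obj y^T / mu)))).
  by apply: (continuous_big mul_continuous) => i _; exact: slack_continuous.
apply: (@continuous_comp _ _ _ (fun y : 'rV[R]_n => - (obj y^T / mu)) expR).
  apply: continuousN; apply: continuousM; last exact: cst_continuous.
  exact: objective_continuous.
exact: continuous_expR.
Qed.

Lemma sublevel_compact (beta : R) : bounded_sublevel_sets A b cobj W ->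
  compact [set y : 'rV[R]_n | feasible A b y^T /\ obj y^T <= beta]%classic.
Proof.
move=> /(_ beta)[M hM]; apply: bounded_closed_compact.
  exists M; split; first exact: num_real.
  move=> M' MM' y [fy oy] /=; have -> : `|y| = mx_norm y by [].
  rewrite mx_normrE.
  have yM : enorm y^T <= M by exact: hM.
  apply: bigmax_le => [|[i j] _]/=.
    by apply: le_trans (ltW MM'); apply: le_trans yM; exact: enorm_ge0.
  apply: le_trans (ltW MM'); apply: le_trans yM.
  by have := coord_le_enorm y^T j; rewrite mxE ord1.
have -> : [set y : 'rV[R]_n | feasible A b y^T /\ obj y^T <= beta]%classic =
    (\bigcap_(i in [set: 'I_m])
       ((fun y : 'rV[R]_n => (A *m y^T + b) i 0) @^-1` [set r | 0 <= r]) `&`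
     (fun y : 'rV[R]_n => obj y^T) @^-1` [set r | r <= beta])%classic.
  apply/seteqP; split => y [fy oy]; split => // i; last exact: fy.
  by move=> _; exact: fy.
apply: closedI.
  apply: closed_bigI => i _; apply: preimage_closed; last exact: closed_ge.
  by move=> y _; exact: slack_continuous.
apply: preimage_closed; last exact: closed_le.
by move=> y _; exact: objective_continuous.
Qed.

(* Maximize the barrier over the compact sublevel set at level
   [obj x0 + m * mu + 1]. First-order optimality in the direction of [x0] gives
   [obj x - obj x0 <= m * mu] at the maximizer [x], so the constraint on [obj] is
   inactive there and the gradient vanishes. *)
Lemma centered_point_exists : bounded_sublevel_sets A b cobj W ->
  (exists x, strictly_feasible A b x) ->
  is_centered A b cobj W mu (centered_point A b cobj W mu).
Proof.
move=> hbnd [x0 sx0].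
apply: (@xgetPex _ 0 [set v | is_centered A b cobj W mu v]%classic).
pose beta := obj x0 + m%:R * mu + 1.
pose K := [set y : 'rV[R]_n | feasible A b y^T /\ obj y^T <= beta]%classic.
have ox0 : obj x0 <= beta.
  by rewrite /beta -addrA lerDl addr_ge0// mulr_ge0// ltW.
have Kx0 : K x0^T by rewrite /K/= trmxK; split => // i; exact: ltW.
have [||y Ky ymax] := @EVT_max_rV _ _ (fun y => barrier y^T) K _
  (sublevel_compact (beta:=beta) hbnd).
- by exists x0^T.
- by apply: continuous_subspaceT; exact: barrier_continuous.
move: Ky; rewrite inE => -[]; set x := y^T => fx ox.
have {}ymax z : feasible A b z -> obj z <= beta -> barrier z <= barrier x.
  by move=> fz oz; rewrite -[z]trmxK; apply: ymax; rewrite inE /K/= trmxK.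
(* A zero slack would make the barrier vanish at [x], whereas its value there is at least the
   positive one at [x0]. *)
have sx : strictly_feasible A b x.
  have bx0 : 0 < barrier x.
    by apply: (lt_le_trans (barrier_gt0 sx0)); apply: ymax => // i; exact: ltW.
  move=> i; rewrite lt_neqAle fx andbT eq_sym; apply/eqP => si0.
  by move: bx0; rewrite /barrier (bigD1 i)//= si0 !mul0r ltxx.
have {ox}ox : obj x < beta.
  pose h := x0 - x.
  have o1 : obj x0 = obj x + slope x h + curvature h / 2.
    rewrite -[x0](subrKC x) -/h -[h in LHS]scale1r objective_expand; by field.
  have w0 := curvature_ge0 h.
  have hdir (t : R) : 0 < t -> t <= 1 -> barrier (x + t *: h) <= barrier x.
    move=> t0 t1; apply: ymax.
      move=> i; rewrite slackD /h mulmxBr.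
      rewrite [(A *m x0 - _) i 0]mxE [(- (A *m x)) i 0]mxE.
      have := fx i; have := sx0 i; rewrite ![(_ + b) i 0]mxE; nra.
    rewrite objective_expand.
    have -> : obj x + t * slope x h + t ^+ 2 / 2 * curvature h =
        (1 - t) * obj x + t * obj x0 - t * (1 - t) * curvature h / 2.
      by rewrite o1; field.
    have : 0 <= t * (1 - t) * curvature h by rewrite !mulr_ge0// ?subr_ge0// ltW.
    have : (1 - t) * obj x <= (1 - t) * beta by rewrite ler_wpM2l// subr_ge0.
    have : t * obj x0 <= t * beta by rewrite ler_wpM2l// ltW.
    lra.
  have := barrier_direction sx ltr01 hdir.
  rewrite -(ler_pM2r mu_gt0) divfK ?gt_eqF// => H.
  (* [A *m h] is the slack at [x0] minus the slack at [x], so each ratio is at least -1. Hence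
     [slope x h >= - (m * mu)], and convexity gives [obj x <= obj x0 + m * mu]. *)
  have : - m%:R <= \sum_i (A *m h) i 0 / (A *m x + b) i 0.
    have -> : - m%:R = \sum_(i < m) (-1 : R) by rewrite sumr_const card_ord mulNrn.
    apply: ler_sum => i _; rewrite ler_pdivlMr ?sx//.
    have := sx0 i; rewrite /h mulmxBr !mxE; lra.
  by rewrite -(ler_pM2r mu_gt0) => mH; rewrite /beta; lra.
(* No constraint is active at [x], so every direction is admissible for short steps: [t1] keeps the
   slacks nonnegative and [t2] keeps the objective below [beta]. Applying this to [- h] as well
   yields equality. *)
have opt h : \sum_i (A *m h) i 0 / (A *m x + b) i 0 <= slope x h / mu.
  pose S := \sum_i `|(A *m h) i 0 / (A *m x + b) i 0|.
  have S0 : 0 <= S by rewrite sumr_ge0.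
  pose G := `|slope x h| + curvature h.
  have G0 : 0 <= G by rewrite addr_ge0// curvature_ge0.
  have [t1 [t10 t11 t1S]] := exists_small S0 ltr01.
  have gap : 0 < beta - obj x by rewrite subr_gt0.
  have [t2 [t20 t21 t2G]] := exists_small G0 gap.
  apply: (@barrier_direction x h (Num.min t1 t2)) => //.
    by rewrite lt_min t10.
  move=> t t0; rewrite le_min => /andP[tt1 tt2]; apply: ymax.
    move=> i; rewrite slackD.
    have si := sx i.
    have : `|(A *m h) i 0| / (A *m x + b) i 0 <= S.
      rewrite -{1}(gtr0_norm si) -normf_div /S (bigD1 i)//= lerDl.
      exact: sumr_ge0.
    rewrite ler_pdivrMr// => aS.
    have : - `|(A *m h) i 0| <= (A *m h) i 0 by rewrite lerNl -normrN ler_norm.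
    have tS : t * S < 1 by apply: le_lt_trans t1S; exact: ler_wpM2r.
    move=> aa.
    have : t * - (S * (A *m x + b) i 0) <= t * (A *m h) i 0.
      by rewrite ler_pM2l//; lra.
    by nra.
  have tG : t * G < beta - obj x by apply: le_lt_trans t2G; exact: ler_wpM2r.
  rewrite objective_expand.
  have w0 := curvature_ge0 h.
  have sl : t * slope x h <= t * `|slope x h| by rewrite ler_pM2l// ler_norm.
  have cu : t ^+ 2 / 2 * curvature h <= t * curvature h.
    by apply: ler_wpM2r => //; nra.
  by rewrite /G in tG; lra.
have {}opt h : \sum_i (A *m h) i 0 / (A *m x + b) i 0 = slope x h / mu.
  apply/eqP; rewrite eq_le opt/=.
  have := opt (- h); rewrite /slope mulmxN linearN/= mulNmx !mxE mulNr.
  under eq_bigr do rewrite mxE mulNr.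
  by rewrite sumrN lerN2.
have s0 : 0 < Num.sqrt mu by rewrite sqrtr_gt0.
(* The second centering equation forces this [v]; the first one is stationarity along the coordinate
   directions [delta_mx j 0]. *)
exists (\col_i ln (Num.sqrt mu / (A *m x + b) i 0)), x; split; last first.
  move: sx; rewrite /strictly_feasible; move: (A *m x + b) => r sr.
  apply/colP => i; rewrite !mxE.
  by rewrite expRN lnK ?posrE ?divr_gt0// invf_div mulrC divfK// gt_eqF.
rewrite scalemxAr; apply/colP => j.
have := opt (delta_mx j 0) => /(congr1 ( *%R mu)).
rewrite [RHS]mulrC divfK ?gt_eqF// /slope trmx_delta -rowE => Ej.
have {Ej} -> : (W *m x + cobj) j 0 = mu * \sum_i A i j / (A *m x + b) i 0.
  have -> : (W *m x + cobj) j 0 = row j (W *m x + cobj) 0 0 by rewrite [RHS]mxE.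
  by rewrite -Ej; congr (_ * _); apply: eq_bigr => i _; rewrite -colE mxE.
move: sx; rewrite /strictly_feasible; move: (A *m x + b) => r sr.
rewrite mulr_sumr mxE; apply: eq_bigr => i _; rewrite !mxE.
rewrite lnK ?posrE ?divr_gt0// -[mu in RHS](sqr_sqrtr (ltW mu_gt0)).
by ring.
Qed.

End CenteredPointExistence.

(** * Convergence and iteration count of [shortstep] *)

Section ShortStep.
Variables (R : realType) (m n : nat).
Variables (A : 'M[R]_(m, n)) (b : 'cV[R]_m) (cobj : 'cV[R]_n) (W : 'M[R]_n).
Hypothesis m_gt0 : (0 < m)%N.
Hypothesis W_psd : pos_semidef W.
Hypothesis has_interior : exists x : 'cV[R]_n, strictly_feasible A b x.
Hypothesis bounded : bounded_sublevel_sets A b cobj W.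
Hypothesis AW_pd : pos_def (A^T *m A + W).

Local Notation vhat := (centered_point A b cobj W).
Local Notation step := (newton_step A b cobj W).
Local Notation qdist u v := (qsum (u - v)).

Lemma vhatP mu : 0 < mu -> is_centered A b cobj W mu (vhat mu).
Proof. by move=> mu0; exact: centered_point_exists. Qed.

Lemma newton_step_qdist (mu : R) v : 0 < mu -> qdist (vhat mu) v <= 1 / 2 ->
  qdist (vhat mu) (step mu v) <= qdist (vhat mu) v ^+ 2.
Proof.
move=> mu0 h; rewrite /newton_step opprD addrA; apply: qsum_newton => //.
apply: (newton_direction_sinh W_psd mu0 (vhatP mu0)).
exact: newton_direction_exists.
Qed.

Lemma newton_iter_qdist (mu theta : R) v j : 0 < mu -> theta <= 1 / 2 ->
  qdist (vhat mu) v <= theta ->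
  qdist (vhat mu) (iter j (step mu) v) <= theta ^+ (2 ^ j).
Proof.
move=> mu0 t12 hv.
have t0 : 0 <= theta by apply: le_trans hv; exact: qsum_ge0.
elim: j => [|j IH]; first by rewrite expr1.
rewrite iterS expnSr exprM; apply: le_trans (newton_step_qdist mu0 _) _.
  (* As [theta <= 1], its power is at most [theta], so the iterate remains where [newton_step_qdist]
     applies. *)
  apply: (le_trans IH); apply: (le_trans _ t12).
  by apply: ler_iXnr; rewrite ?expn_gt0//; lra.
by rewrite ler_sqr ?nnegrE ?qsum_ge0// exprn_ge0.
Qed.

Variables (theta eps k : R) (N : nat).
Hypotheses (theta_gt0 : 0 < theta) (theta_le : theta <= 2^-1).
Hypotheses (eps_gt0 : 0 < eps) (eps_lt : eps < qinv theta).
Let zeta := qinv theta - eps.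
Hypothesis theta_N : theta ^+ (2 ^ N) <= eps ^+ 2.
Hypothesis ln_k : 2^-1 * ln k = qinv (m%:R^-1 * zeta ^+ 2).

Lemma zeta_gt0 : 0 < zeta. Proof. by rewrite subr_gt0. Qed.

Lemma ln_k_gt0 : 0 < ln k.
Proof.
have : 0 < 2^-1 * ln k.
  by rewrite ln_k qinv_gt0// mulr_gt0 ?exprn_gt0 ?zeta_gt0// invr_gt0 ltr0n.
by rewrite pmulr_rgt0.
Qed.

(** Positivity of [ln k] also excludes [k <= 0], where [ln] takes a default value, since [ln_le0]
    covers every [k <= 1]. *)
Lemma k_gt1 : 1 < k.
Proof.
by rewrite ltNge; apply/negP => /ln_le0; rewrite leNgt ln_k_gt0.
Qed.

Lemma k_gt0 : 0 < k. Proof. exact: lt_trans k_gt1. Qed.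

Lemma vhat_step (mu : R) : 0 < mu -> enorm (vhat (mu / k) - vhat mu) <= zeta.
Proof.
move=> mu0; have muk0 : 0 < mu / k by rewrite divr_gt0// k_gt0.
rewrite -ler_sqr ?nnegrE ?enorm_ge0 ?(ltW zeta_gt0)//.
apply: le_trans (enorm_le_qsum _) _.
rewrite -qsumN opprB; apply: le_trans.
  exact: (centered_shift W_psd mu0 muk0 (vhatP mu0) (vhatP muk0)).
have -> : mu / (mu / k) = k by field; rewrite !gt_eqF ?k_gt0.
rewrite ln_k qinvK.
  by rewrite mulrA mulfV ?mul1r// pnatr_eq0 -lt0n.
by rewrite mulr_ge0 ?sqr_ge0// invr_ge0.
Qed.

Lemma outer_step (mu : R) v : 0 < mu -> enorm (v - vhat mu) <= eps ->
  enorm (iter N (step (mu / k)) v - vhat (mu / k)) <= eps.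
Proof.
move=> mu0 hv; have muk0 : 0 < mu / k by rewrite divr_gt0// k_gt0.
have h : enorm (vhat (mu / k) - v) <= qinv theta.
  rewrite -(subrKA (vhat mu)); apply: le_trans (enorm_triangle _ _) _.
  have := vhat_step mu0; rewrite -(enorm_opp (vhat mu - v)) opprB /zeta; lra.
have qh : qdist (vhat (mu / k)) v <= theta.
  apply: le_trans (qsum_le_enorm _) _.
  rewrite -[X in _ <= X](qinvK (ltW theta_gt0)).
  by apply: q_le; first exact: enorm_ge0.
rewrite -enorm_opp opprB -ler_sqr ?nnegrE ?enorm_ge0 ?(ltW eps_gt0)//.
apply: le_trans (enorm_le_qsum _) _; apply: le_trans theta_N.
by apply: newton_iter_qdist => //; rewrite div1r.
Qed.

(** [j] counts the outer iterations. The last one is entered with parameter [mu / k ^+ j.-1], still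
    above [muf]; hence the exponent [j.-1] and the restriction to [0 < j]. *)
Lemma shortstep_invariant (muf : R) v mu v' mu' s :
  shortstep A b cobj W k N muf v mu v' mu' s -> 0 < mu ->
  enorm (v - vhat mu) <= eps ->
  [/\ enorm (v' - vhat mu') <= eps, mu' <= muf &
    exists2 j, s = (N * j)%N & (0 < j)%N -> muf * k ^+ j.-1 < mu].
Proof.
elim=> [{}v {}mu mumuf _ hv|{}v {}mu {}v' {}mu' {}s mufmu _ IH mu0 hv].
  by split=> //; exists 0; rewrite ?muln0.
have muk0 : 0 < mu / k by rewrite divr_gt0// k_gt0.
have [hv' mu'muf [j -> hj]] := IH muk0 (outer_step mu0 hv).
split=> //; exists j.+1; rewrite ?mulnS// => _ /=.
case: j hj => [_|j /(_ isT)/=]; first by rewrite expr0 mulr1.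
by rewrite ltr_pdivlMr ?k_gt0// exprSr mulrA.
Qed.

Lemma shortstep_terminates (muf mu : R) v : 0 < muf ->
  exists v' mu' s, shortstep A b cobj W k N muf v mu v' mu' s.
Proof.
move=> muf0.
have [j] : exists j, mu <= muf * k ^+ j.
  pose x := Num.max 0 ((mu / muf - 1) / (k - 1)).
  have k1 : 0 < k - 1 by rewrite subr_gt0 k_gt1.
  exists (Num.truncn x).+1.
  have : x < (Num.truncn x).+1%:R by exact: truncnS_gt.
  set j := (Num.truncn x).+1 => xj.
  have : (mu / muf - 1) / (k - 1) < j%:R.
    by apply: le_lt_trans xj; rewrite le_max lexx orbT.
  rewrite ltr_pdivrMr// => hj.
  (* Bernoulli's inequality: the linear growth already brings [k ^+ j] above [mu / muf] for the
     chosen [j]. *)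
  have bern i : 1 + i%:R * (k - 1) <= k ^+ i.
    elim: i => [|i IH]; first by rewrite mul0r addr0.
    rewrite exprSr -natr1.
    have : (1 + i%:R * (k - 1)) * k <= k ^+ i * k by rewrite ler_pM2r// k_gt0.
    have := mulr_ge0 (ler0n R i) (sqr_ge0 (k - 1)); lra.
  rewrite mulrC -ler_pdivrMr//; have := bern j; lra.
elim: j mu v => [|j IH] mu v hmu.
  by exists v, mu, 0; apply: shortstep_exit; rewrite expr0 mulr1 in hmu.
have [mumuf|mufmu] := leP mu muf; first by exists v, mu, 0; exact: shortstep_exit.
have [|v' [mu' [s H]]] := IH (mu / k) (iter N (step (mu / k)) v).
  by rewrite ler_pdivrMr ?k_gt0// -mulrA -exprSr.
by exists v', mu', (N + s)%N; exact: shortstep_loop.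
Qed.

(* [sqrt m] copies of [ln k / 2] recombine into a vector of norm [qinv (zeta ^+ 2)]:
   this is the superadditivity of [q] applied to a constant vector. *)
Lemma ln_k_ge : 2 * qinv (zeta ^+ 2) <= Num.sqrt m%:R * ln k.
Proof.
have mR : 0 < m%:R :> R by rewrite ltr0n.
have sm : 0 < Num.sqrt m%:R :> R by rewrite sqrtr_gt0.
have z0 : 0 <= zeta ^+ 2 by exact: sqr_ge0.
set t := qinv (zeta ^+ 2); have t0 : 0 <= t by exact: qinv_ge0.
suff : t / Num.sqrt m%:R <= 2^-1 * ln k by rewrite ler_pdivrMr//; lra.
rewrite ln_k; apply: le_qinv; first by rewrite mulr_ge0// invr_ge0.
rewrite mulrC -(qinvK z0) -/t.
have -> : m%:R^-1 * q t = (Num.sqrt m%:R)^-1 ^+ 2 * q t.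
  by rewrite exprVn sqr_sqrtr// ltW.
apply: q_scale; rewrite invr_ge0 ltW//= invf_le1//.
by rewrite -[X in X <= _]sqrtr1 ler_sqrt// ler1n.
Qed.

Lemma outer_iterations_le (mu muf : R) j : 0 < muf -> muf < mu ->
  ((0 < j)%N -> muf * k ^+ j.-1 < mu) ->
  j%:Z <= Num.ceil ((2 * qinv (zeta ^+ 2))^-1 * Num.sqrt m%:R * ln (mu / muf)).
Proof.
move=> muf0 mufmu hj; have mu0 : 0 < mu by exact: lt_trans mufmu.
set c := 2 * _.
have c0 : 0 < c by rewrite mulr_gt0// qinv_gt0// exprn_gt0// zeta_gt0.
have l0 : 0 < ln (mu / muf) by rewrite ln_gt0// ltr_pdivlMr// mul1r.
have sm : 0 < Num.sqrt m%:R :> R by rewrite sqrtr_gt0 ltr0n.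
case: j hj => [_|j /(_ isT)/= hj].
  by rewrite ceil_ge0 (lt_trans (ltrN10 _))// !mulr_gt0 ?invr_gt0.
have lnj : j%:R * ln k < ln (mu / muf).
  rewrite mulr_natl -lnXn ?k_gt0// ltr_ln ?posrE ?divr_gt0 ?exprn_gt0 ?k_gt0//.
  by rewrite ltr_pdivlMr// mulrC.
(* Here [j] is the number of iterations minus one. For an integer, lying strictly below a real is
   the same as lying strictly below its ceiling, which absorbs the extra iteration. *)
rewrite -addn1 PoszD lezD1 ceil_gt_int -mulrA ltr_pdivlMl//.
apply: (@le_lt_trans _ _ (Num.sqrt m%:R * (j%:R * ln k))); last by rewrite ltr_pM2l.
rewrite -pmulrn [c * _]mulrC [leRHS]mulrCA ler_wpM2l//; exact: ln_k_ge.
Qed.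

End ShortStep.

(** [shortstep] is a relation, so termination is a separate conjunct; the bounds alone would hold
    vacuously if no run ended. *)
Theorem theorem3p1 (R : realType) (m n : nat) (hm : (0 < m)%N)
    (A : 'M[R]_(m, n)) (b : 'cV[R]_m) (cobj : 'cV[R]_n) (W : 'M[R]_n)
    (hW : pos_semidef W)
    (hstrict : exists x : 'cV[R]_n, strictly_feasible A b x)
    (hbounded : bounded_sublevel_sets A b cobj W)
    (hposdef : pos_def (A^T *m A + W))
    (theta eps : R)
    (htheta0 : 0 < theta) (htheta : theta <= 2^-1)
    (heps0 : 0 < eps) (heps : eps < qinv theta)
    (k : R) (N : nat) (hN : (0 < N)%N) :
  let zeta := qinv theta - eps in
  let c := 2 * qinv (zeta ^+ 2) in
  theta ^+ (2 ^ N) <= eps ^+ 2 ->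
  2^-1 * ln k = qinv (m%:R^-1 * zeta ^+ 2) ->
  forall mu0 muf : R, 0 < muf -> muf < mu0 ->
  let v0 := centered_point A b cobj W mu0 in
  (exists (v : 'cV[R]_m) (mu : R) (s : nat),
     shortstep A b cobj W k N muf v0 mu0 v mu s) /\
  (forall (v : 'cV[R]_m) (mu : R) (s : nat),
     shortstep A b cobj W k N muf v0 mu0 v mu s ->
     s%:Z <= N%:Z * Num.ceil (c^-1 * Num.sqrt m%:R * ln (mu0 / muf)) /\
     (enorm (v - centered_point A b cobj W mu) <= eps /\ mu <= muf)).
Proof.
move=> zeta c htN hk mu0 muf hmuf hmu v0; split.
  exact: (shortstep_terminates A b cobj W hm N heps hk).
move=> v mu s /(shortstep_invariant hm hW hstrict hbounded hposdef
  htheta0 htheta heps0 heps htN hk).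
case; first exact: lt_trans hmu.
  by rewrite subrr enorm0 ltW.
move=> hv hmu' [j -> hj]; split=> //.
rewrite PoszM ler_wpM2l//.
exact: (outer_iterations_le hm heps hk).
Qed.
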